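(* The $\gamma$-dual of each of the spaces $cs^{\lambda}$, $cs_0^{\lambda}$ and $bs^{\lambda}$ is the set $m_3^{\lambda}\cap m_4^{\lambda}$, where $$m_3^{\lambda}=\left\{a=(a_k)\in w:\sum_{k=0}^{\infty}\left|\bar{\Delta}\left(\bar{\Delta}\left(\frac{a_k}{\lambda_k-\lambda_{k-1}}\right)\lambda_k\right)\right|<\infty\right\},$$ $$m_4^{\lambda}=\left\{a=(a_k)\in w:\sup_k\left|\frac{\lambda_k}{\lambda_k-\lambda_{k-1}}a_k\right|<\infty\right\}.$$
   Context: $\mathbb{N}=\{0,1,2,\dots\}$ and $w=\mathbb{C}^{\mathbb{N}}$ is the space of all complex sequences. $\lambda=(\lambda_k)_{k\in\mathbb{N}}$ is a fixed strictly increasing sequence of positive reals tending to infinity, with the convention $\lambda_{-1}=0$. For $x=(x_k)\in w$ put $\Lambda(x)=(\Lambda_n(x))_{n\in\mathbb{N}}$, $\Lambda_n(x)=\frac{1}{\lambda_n}\sum_{k=0}^{n}(\lambda_k-\lambda_{k-1})x_k$. $\bar{\Delta}$ is the difference $\bar{\Delta}(u_k)=u_k-u_{k+1}$; in particular $\bar{\Delta}\left(\frac{a_k}{\lambda_k-\lambda_{k-1}}\right)=\frac{a_k}{\lambda_k-\lambda_{k-1}}-\frac{a_{k+1}}{\lambda_{k+1}-\lambda_k}$ for all $k\in\mathbb{N}$. $cs$, $cs_0$, $bs$ are the spaces of sequences $x\in w$ whose sequence of partial sums $\left(\sum_{n=0}^m x_n\right)_m$ is, respectively, convergent, convergent to $0$,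 bounded. Define $cs^{\lambda}=\{x\in w:\Lambda(x)\in cs\}$, $cs_0^{\lambda}=\{x\in w:\Lambda(x)\in cs_0\}$, $bs^{\lambda}=\{x\in w:\Lambda(x)\in bs\}$. The $\gamma$-dual of a sequence space $X$ is $X^{\gamma}=\{a\in w: (a_kx_k)\in bs\ \text{for all}\ x=(x_k)\in X\}$. *)

(* Defs.v *)
(* Standard-library reals with Coquelicot. *)
From Stdlib Require Import Reals.
From Coquelicot Require Import Coquelicot.

Open Scope R_scope.

Definition cseq : Type := nat -> C.

(* A set of sequences, given by its membership predicate. *)
Definition seq_space : Type := cseq -> Prop.

(* lam k - lam (k-1), with the convention lam (-1) = 0. *)
Definition dlam (lam : nat -> R) (k : nat) : R :=
  match k with
  | O => lam O
  | S k' => lam k - lam k'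
  end.

Definition Lam (lam : nat -> R) (x : cseq) : cseq := fun n =>
  (/ RtoC (lam n) *
     sum_n (G := C_AbelianMonoid) (fun k => RtoC (dlam lam k) * x k) n)%C.

Definition Dbar (u : cseq) : cseq := fun k => (u k - u (S k))%C.

Definition cs : seq_space := fun x => ex_series (V := C_NormedModule) x.

Definition cs0 : seq_space := fun x =>
  is_series (V := C_NormedModule) x (RtoC 0).

Definition bs : seq_space := fun x =>
  exists M : R, forall m : nat,
    Cmod (sum_n (G := C_AbelianMonoid) x m) <= M.

Definition cs_lam (lam : nat -> R) : seq_space := fun x => cs (Lam lam x).
Definition cs0_lam (lam : nat -> R) : seq_space := fun x => cs0 (Lam lam x).
Definition bs_lam (lam : nat -> R) : seq_space := fun x => bs (Lam lam x).

Definition gamma_dual (X : seq_space) : seq_space := fun a =>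
  forall x : cseq, X x -> bs (fun k => (a k * x k)%C).

Definition m3_lam (lam : nat -> R) : seq_space := fun a =>
  ex_series (fun k : nat =>
    Cmod (Dbar (fun j =>
            Dbar (fun i => a i / RtoC (dlam lam i)) j * RtoC (lam j))%C k)).

Definition m4_lam (lam : nat -> R) : seq_space := fun a =>
  Rbar_lt
    (Sup_seq (fun k : nat =>
       Finite (Cmod (RtoC (lam k) / RtoC (dlam lam k) * a k)%C)))
    p_infty.

(* Main.v *)
(** With [b k = a k / dlam k], [c k = Dbar b k * lam k], [y = Lam x] and [s] the
    partial sums of [y], two summations by parts give
      [sum_{k<=n} a k x k =
         sum_{k<=n} Dbar c k s k + c (n+1) s n + b (n+1) lam n y n].
    Bounded [s] and the two conditions on [a] bound the right-hand side.
    Conversely [x |-> s] is a bijection, so the right-hand side is a triangular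
    matrix transformation of an arbitrary null sequence [s]; if it is always
    bounded, a gliding hump argument bounds the absolute row sums, whose
    diagonal terms are [b n lam n] and whose other terms, the last but one
    excepted, are [Dbar c k]. *)
Require Import Defs.
From Stdlib Require Import Reals Lra Lia Classical ClassicalEpsilon.
From Coquelicot Require Import Coquelicot.

Open Scope R_scope.

(** * Finite sums, summation by parts and complex signs *)

Notation csum := (sum_n (G := C_AbelianMonoid)).
Notation rsum := (sum_n (G := R_AbelianMonoid)).

(* [ring] and [field] do not see through the carrier of [C_AbelianMonoid]. *)
Ltac at_C := match goal with |- @eq _ ?x ?y => change (@eq C x y) end.
Ltac cring := intros; at_C; ring.
Ltac cfield := intros; at_C; field.

Lemma csum_S (u : cseq) (n : nat) : csum u (S n) = (csum u n + u (S n))%C.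
Proof. exact (sum_Sn u n). Qed.

Lemma csum_0 (u : cseq) : csum u 0 = u 0%nat.
Proof. exact (sum_O u). Qed.

Lemma rsum_S (u : nat -> R) (n : nat) : rsum u (S n) = rsum u n + u (S n).
Proof. exact (sum_Sn u n). Qed.

Lemma rsum_0 (u : nat -> R) : rsum u 0 = u 0%nat.
Proof. exact (sum_O u). Qed.

Lemma csum_plus (u v : cseq) (n : nat) :
  csum (fun k => u k + v k)%C n = (csum u n + csum v n)%C.
Proof. exact (sum_n_plus u v n). Qed.

Lemma rsum_le (u v : nat -> R) (n : nat) :
  (forall k, (k <= n)%nat -> u k <= v k) -> rsum u n <= rsum v n.
Proof.
  induction n as [|n IH]; intros H.
  - rewrite !rsum_0; apply H; lia.
  - rewrite !rsum_S; apply Rplus_le_compat; [apply IH; intros|]; apply H; lia.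
Qed.

Lemma rsum_le_len (u : nat -> R) (m n : nat) :
  (forall k, 0 <= u k) -> (m <= n)%nat -> rsum u m <= rsum u n.
Proof.
  intros H; induction 1 as [|n _ IH]; [lra|].
  rewrite rsum_S; specialize (H (S n)); lra.
Qed.

Lemma rsum_term_le (u : nat -> R) (k n : nat) :
  (forall k, 0 <= u k) -> (k <= n)%nat -> u k <= rsum u n.
Proof.
  intros H kn; apply Rle_trans with (rsum u k); [|now apply rsum_le_len].
  destruct k as [|k]; [rewrite rsum_0; lra|].
  assert (0 <= rsum u k); [|rewrite rsum_S; lra].
  clear kn; induction k as [|k IH]; [rewrite rsum_0; apply H|].
  rewrite rsum_S; specialize (H (S k)); lra.
Qed.

Lemma rsum_lin (p q : R) (u v : nat -> R) (n : nat) :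
  rsum (fun k => p * u k + q * v k) n = p * rsum u n + q * rsum v n.
Proof.
  induction n as [|n IH]; [now rewrite !rsum_0|].
  rewrite !rsum_S, IH.
  change (p * rsum u n + q * rsum v n + (p * u (S n) + q * v (S n)) =
    p * (rsum u n + u (S n)) + q * (rsum v n + v (S n)) :> R); ring.
Qed.

(** The left side stops growing past [m]; this bounds the columns before a hump independently of the
    row length [n]. *)
Lemma rsum_truncate_le (u : nat -> R) (m n : nat) :
  (forall k, 0 <= u k) ->
  rsum (fun k => if (k <? m)%nat return R then u k else 0) n <= rsum u m.
Proof.
  intros H; destruct (Nat.le_gt_cases n m) as [nm|mn].
  - apply Rle_trans with (rsum u n); [|now apply rsum_le_len].
    apply rsum_le; intros k _; specialize (H k); destruct (k <? m)%nat; lra.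
  - induction mn as [|n mn IH]; rewrite rsum_S.
    + destruct (Nat.ltb_spec (S m) m); [lia|].
      assert (rsum (fun k => if (k <? m)%nat return R then u k else 0) m <= rsum u m);
        [|lra].
      apply rsum_le; intros k _; specialize (H k); destruct (k <? m)%nat; lra.
    + destruct (Nat.ltb_spec (S n) m); [lia|]; lra.
Qed.

Lemma Cmod_csum_le (u : cseq) (n : nat) :
  Cmod (csum u n) <= rsum (fun k => Cmod (u k)) n.
Proof.
  induction n as [|n IH]; [rewrite csum_0, rsum_0; lra|].
  rewrite csum_S, rsum_S.
  apply Rle_trans with (1 := Cmod_triangle _ _); lra.
Qed.

Lemma Re_csum (u : cseq) (n : nat) :
  Re (csum u n) = rsum (fun k => Re (u k)) n.
Proof.
  induction n as [|n IH]; [now rewrite csum_0, rsum_0|].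
  now rewrite csum_S, rsum_S, <- IH.
Qed.

Lemma csum_delta (v : cseq) (m n : nat) :
  csum (fun k => if (k =? m)%nat then v k else RtoC 0) n =
  if (m <=? n)%nat then v m else RtoC 0.
Proof.
  induction n as [|n IH].
  - rewrite csum_0; now destruct m.
  - rewrite csum_S, IH.
    destruct (Nat.leb_spec m n), (Nat.leb_spec m (S n)), (Nat.eqb_spec (S n) m);
      subst; try lia; cring.
Qed.

(** Backward difference with the convention [u (-1) = 0], which makes it inverse to partial
    summation. *)
Definition bdiff (u : cseq) : cseq := fun k =>
  match k with
  | O => u O
  | S k' => (u (S k') - u k')%C
  end.

Lemma csum_bdiff (u : cseq) (n : nat) : csum (bdiff u) n = u n.
Proof.
  induction n as [|n IH]; [apply (csum_0 (bdiff u))|].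
  rewrite csum_S, IH; simpl; cring.
Qed.

Lemma bdiff_csum (u : cseq) (n : nat) : bdiff (csum u) n = u n.
Proof.
  destruct n as [|n]; simpl; [apply csum_0|].
  rewrite csum_S; cring.
Qed.

Lemma csum_by_parts (u v : cseq) (n : nat) :
  csum (fun k => u k * bdiff v k)%C n =
  (csum (fun k => Dbar u k * v k) n + u (S n) * v n)%C.
Proof.
  induction n as [|n IH].
  - rewrite !csum_0; unfold Dbar; simpl; cring.
  - rewrite !csum_S, IH; unfold Dbar; simpl; cring.
Qed.

(** Take [u] to be the conjugate of [z] over its modulus, and 0 when [z] vanishes; hence only
    [Cmod u <= 1]. *)
Lemma unimodular_conj (z : C) : exists u : C, Cmod u <= 1 /\ Re (z * u)%C = Cmod z.
Proof.
  destruct (Req_dec (Cmod z) 0) as [z0|z0].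
  - exists (RtoC 0); rewrite Cmod_0, z0; split; [lra|].
    rewrite Cmult_0_r; reflexivity.
  - exists (Cconj z * RtoC (/ Cmod z))%C.
    assert (0 < Cmod z) by (pose proof (Cmod_ge_0 z); lra).
    split.
    + rewrite Cmod_mult, Cmod_conj, Cmod_R, Rabs_pos_eq.
      * right; field; lra.
      * left; now apply Rinv_0_lt_compat.
    + assert (E : Cmod z * Cmod z = fst z * fst z + snd z * snd z).
      { unfold Cmod; rewrite sqrt_sqrt by nra; ring. }
      apply Rmult_eq_reg_r with (Cmod z); [|exact z0].
      rewrite E; destruct z as [p q]; unfold Cconj, Cmult, RtoC, Re; simpl in *.
      field; exact z0.
Qed.

Lemma block_index (K : nat -> nat) (k : nat) :
  K 0%nat = 0%nat -> (forall j, (K j < K (S j))%nat) ->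
  exists j, (K j <= k < K (S j))%nat.
Proof.
  intros K0 KS; induction k as [|k [j Hj]].
  - exists 0%nat; specialize (KS 0%nat); lia.
  - destruct (Nat.lt_ge_cases (S k) (K (S j))).
    + exists j; lia.
    + exists (S j); specialize (KS (S j)); lia.
Qed.

(** This is the form to which [is_series] with sum 0 unfolds on partial sums, so a null [s] directly
    witnesses membership in [cs0]. *)
Definition null_seq (s : cseq) : Prop :=
  filterlim s eventually (locally (T := C_NormedModule) (RtoC 0)).

Lemma null_seq_intro (s : cseq) :
  (forall eps, 0 < eps -> exists N, forall n, (N <= n)%nat -> Cmod (s n) < eps) ->
  null_seq s.
Proof.
  intros H.
  apply (proj2 (filterlim_locally_ball_norm (U := C_NormedModule) s (RtoC 0))).
  intros eps; destruct (H eps (cond_pos eps)) as [N HN].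
  exists N; intros n Hn.
  unfold ball_norm; change (Cmod (s n - RtoC 0)%C < eps).
  replace (s n - RtoC 0)%C with (s n) by cring; auto.
Qed.

(** * Gliding hump for lower triangular matrices *)

Section GlidingHump.

(** Only the entries with [k <= n] matter: [t] is read as a lower triangular matrix. *)
Variable t : nat -> nat -> C.
Hypothesis t_bounded : forall s : cseq, null_seq s ->
  exists M : R, forall n, Cmod (csum (fun k => t n k * s k)%C n) <= M.

(** Testing [t_bounded] on the [k]-th unit sequence isolates column [k]. *)
Lemma columns_bounded : exists B : nat -> R,
  (forall k, 0 <= B k) /\
  forall n k, (k <= n)%nat -> Cmod (t n k) <= B k.
Proof.
  assert (H : forall k, exists M, 0 <= M /\
            forall n, (k <= n)%nat -> Cmod (t n k) <= M).
  { intros k.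
    destruct (t_bounded (fun i => if (i =? k)%nat then RtoC 1 else RtoC 0))
      as [M HM].
    - apply null_seq_intro; intros eps He; exists (S k); intros n Hn.
      destruct (Nat.eqb_spec n k); [lia|]; now rewrite Cmod_0.
    - assert (E : forall n, (k <= n)%nat -> Cmod (t n k) <= M).
      { intros n kn; specialize (HM n).
        rewrite (sum_n_ext _
          (fun i => if (i =? k)%nat then t n i else RtoC 0)) in HM.
        - rewrite csum_delta in HM; destruct (Nat.leb_spec k n); [easy|lia].
        - intros i; destruct (i =? k)%nat; cring. }
      exists M; split; [|exact E].
      apply Rle_trans with (2 := E k (le_n k)), Cmod_ge_0. }
  exists (fun k => proj1_sig (constructive_indefinite_description _ (H k))).
  split; intros; destruct (constructive_indefinite_description _ _) as [M [M0 HM]];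
    simpl; auto.
Qed.

(** If the row sums were unbounded, one could pick successive rows whose mass lies mostly beyond the
    columns already used. A null sequence matching the signs of each such row on its new block, with
    weight [1/(j+1)], would then have unbounded transform. *)
Lemma rows_bounded :
  exists M : R, forall n, rsum (fun k => Cmod (t n k)) n <= M.
Proof.
  apply NNPP; intros unb.
  destruct columns_bounded as [B [B0 HB]].
  assert (big : forall r, exists n, r < rsum (fun k => Cmod (t n k)) n).
  { intros r; apply NNPP; intros no; apply unb; exists r; intros n.
    apply Rnot_lt_le; intros lt; apply no; now exists n. }
  pose (P := fun m => rsum B m).
  (* After division by [j+1], the product leaves [j + 2 P m], and [2 P m] pays for the columns
     before [m]. The extra [P m] excludes rows [n < m], whose sums are at most [P m]. *)
  pose (goal := fun j m => (INR j + 1) * (INR j + 2 * P m) + P m).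
  pose (N := fun j m =>
    proj1_sig (constructive_indefinite_description _ (big (goal j m)))).
  assert (HN : forall j m, goal j m < rsum (fun k => Cmod (t (N j m) k)) (N j m)).
  { intros j m; unfold N.
    now destruct (constructive_indefinite_description _ _). }
  assert (P0 : forall m, 0 <= P m).
  { intros m; apply Rle_trans with (1 := B0 0%nat).
    apply rsum_term_le; [exact B0|lia]. }
  assert (NK : forall j m, (m <= N j m)%nat).
  { intros j m; apply Nat.nlt_ge; intros lt.
    assert (H1 : rsum (fun k => Cmod (t (N j m) k)) (N j m) <= P m).
    { apply Rle_trans with (rsum B (N j m)).
      - apply rsum_le; intros k Hk; now apply HB.
      - apply rsum_le_len; [exact B0|lia]. }
    specialize (HN j m); unfold goal in HN.
    pose proof (P0 m); pose proof (pos_INR j).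
    assert (0 <= (INR j + 1) * (INR j + 2 * P m)) by (apply Rmult_le_pos; lra).
    lra. }
  (* Block [j] ends at the diagonal entry of its row, so that row has no columns in later blocks. *)
  pose (K := fix K j := match j with O => O | S i => S (N i (K i)) end).
  assert (KS : forall j, (K j < K (S j))%nat).
  { intros j; simpl; specialize (NK j (K j)); lia. }
  assert (Kmono : forall i j, (i <= j)%nat -> (K i <= K j)%nat).
  { induction 1 as [|j _ IH]; [lia|]; specialize (KS j); lia. }
  (* [J k] is the index of the block containing [k]. *)
  pose (J := fun k => proj1_sig (constructive_indefinite_description _
    (block_index K k eq_refl KS))).
  assert (HJ : forall k, (K (J k) <= k < K (S (J k)))%nat).
  { intros k; unfold J.
    now destruct (constructive_indefinite_description _ _). }
  assert (Jge : forall j k, (K j <= k)%nat -> (j <= J k)%nat).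
  { intros j k Hk; apply Nat.nlt_ge; intros lt.
    specialize (Kmono (S (J k)) j lt); specialize (HJ k); lia. }
  assert (Jle : forall j k, (k < K (S j))%nat -> (J k <= j)%nat).
  { intros j k Hk; apply Nat.nlt_ge; intros lt.
    specialize (Kmono (S j) (J k) lt); specialize (HJ k); lia. }
  pose (sg := fun z =>
    proj1_sig (constructive_indefinite_description _ (unimodular_conj z))).
  assert (Hsg : forall z, Cmod (sg z) <= 1 /\ Re (z * sg z)%C = Cmod z).
  { intros z; unfold sg; now destruct (constructive_indefinite_description _ _). }
  (* On the block [K j <= k < K (j+1)] the hump aligns [s] with row [N j (K j)]. *)
  pose (s := fun k =>
    (sg (t (N (J k) (K (J k))) k) * RtoC (/ (INR (J k) + 1)))%C).
  assert (pos : forall j, 0 < INR j + 1) by (intros j; pose proof (pos_INR j); lra).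
  assert (ipos : forall j, 0 < / (INR j + 1))
    by (intros j; apply Rinv_0_lt_compat, pos).
  assert (Hs : forall k, Cmod (s k) <= / (INR (J k) + 1)).
  { intros k; unfold s; rewrite Cmod_mult, Cmod_R, Rabs_pos_eq by (left; apply ipos).
    rewrite <- (Rmult_1_l (/ _)) at 2.
    apply Rmult_le_compat_r; [left; apply ipos|apply Hsg]. }
  assert (i1 : forall j, / (INR j + 1) <= 1).
  { intros j; rewrite <- Rinv_1; apply Rinv_le_contravar; [lra|].
    pose proof (pos_INR j); lra. }
  destruct (t_bounded s) as [M HM].
  { apply null_seq_intro; intros eps He.
    destruct (INR_archimed 1 (/ eps)) as [j Hj]; [lra|].
    exists (K j); intros n Hn.
    apply Rle_lt_trans with (1 := Hs n).
    rewrite <- (Rinv_inv eps); apply Rinv_lt_contravar.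
    - apply Rmult_lt_0_compat; [now apply Rinv_0_lt_compat|apply pos].
    - pose proof (le_INR _ _ (Jge _ _ Hn)); lra. }
  (* The row of block [j] takes [s] to a value of real part above [j], so any [j > M] gives the
     contradiction. *)
  destruct (INR_archimed 1 M) as [j Hj]; [lra|].
  specialize (HM (N j (K j))).
  set (n := N j (K j)) in *.
  (* Before the block a term has real part at least [- B k]. A second [B k] absorbs
     [Cmod (t n k) / (j+1)], so that the full row sum appears. On the block the signs give
     equality. *)
  assert (low : rsum (fun k => / (INR j + 1) * Cmod (t n k)
                 + -2 * (if (k <? K j)%nat then B k else 0)) n
              <= Re (csum (fun k => t n k * s k)%C n)).
  { rewrite Re_csum; apply rsum_le; intros k Hk.
    destruct (Nat.ltb_spec k (K j)) as [lt|ge].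
    - assert (H1 := HB n k Hk).
      assert (H2 : Cmod (t n k * s k)%C <= Cmod (t n k)).
      { rewrite Cmod_mult; apply Rle_trans with (Cmod (t n k) * 1); [|lra].
        apply Rmult_le_compat_l; [apply Cmod_ge_0|].
        now apply Rle_trans with (1 := Hs k). }
      assert (H3 := re_le_Cmod (t n k * s k)%C).
      assert (H4 := Rle_abs (- Re (t n k * s k)%C)); rewrite Rabs_Ropp in H4.
      assert (H5 : / (INR j + 1) * Cmod (t n k) <= 1 * Cmod (t n k))
        by (apply Rmult_le_compat_r; [apply Cmod_ge_0|apply i1]).
      lra.
    - assert (Ej : J k = j).
      { apply Nat.le_antisymm; [apply Jle; simpl; fold n; lia|now apply Jge]. }
      unfold s; rewrite Ej; fold n.
      rewrite <- (proj2 (Hsg (t n k))) at 1; right.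
      rewrite Cmult_assoc.
      generalize (t n k * sg (t n k))%C; intros z.
      unfold Re, Cmult, RtoC; simpl; ring. }
  rewrite (rsum_lin (/ (INR j + 1)) (-2)) in low.
  assert (H1 := rsum_truncate_le B (K j) n B0); fold (P (K j)) in H1.
  assert (H2 : INR j + 2 * P (K j)
               < / (INR j + 1) * rsum (fun k => Cmod (t n k)) n).
  { apply Rmult_lt_reg_l with (INR j + 1); [apply pos|].
    rewrite <- Rmult_assoc, Rinv_r, Rmult_1_l by (specialize (pos j); lra).
    specialize (HN j (K j)); specialize (P0 (K j)); unfold goal in HN.
    fold n in HN; lra. }
  set (T := csum (fun k => t n k * s k)%C n) in *.
  assert (H3 := re_le_Cmod T); assert (H4 := Rle_abs (Re T)).
  lra.
Qed.

End GlidingHump.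

(** * The transform [Lam], its inverse and the two conditions on [a] *)

Section Lambda.

Variable lam : nat -> R.
Hypothesis lam_pos : forall k : nat, 0 < lam k.
Hypothesis lam_incr : forall m n : nat, (m < n)%nat -> lam m < lam n.

Lemma dlam_neq_0 (k : nat) : RtoC (dlam lam k) <> RtoC 0.
Proof.
  intros E; apply RtoC_inj in E.
  destruct k as [|k]; simpl in E.
  - specialize (lam_pos 0%nat); lra.
  - specialize (lam_incr k (S k) (Nat.lt_succ_diag_r k)); lra.
Qed.

Lemma lam_neq_0 (k : nat) : RtoC (lam k) <> RtoC 0.
Proof. intros E; apply RtoC_inj in E; specialize (lam_pos k); lra. Qed.

Lemma bdiff_Lam (x : cseq) (k : nat) :
  bdiff (fun i => RtoC (lam i) * Lam lam x i)%C k = (RtoC (dlam lam k) * x k)%C.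
Proof.
  rewrite <- (bdiff_csum (fun k => RtoC (dlam lam k) * x k)%C k).
  unfold Lam; destruct k as [|k]; simpl; cfield; auto using lam_neq_0.
Qed.

(** The identity [bdiff_Lam] solved for [x]. Applied to [bdiff s], it produces an [x] for which
    [Lam lam x] has partial sums [s]. *)
Definition Lam_inv (y : cseq) : cseq := fun k =>
  (bdiff (fun i => RtoC (lam i) * y i) k / RtoC (dlam lam k))%C.

Lemma Lam_Lam_inv (y : cseq) (n : nat) : Lam lam (Lam_inv y) n = y n.
Proof.
  unfold Lam, Lam_inv.
  rewrite (sum_n_ext _ (bdiff (fun i => RtoC (lam i) * y i)%C)).
  - rewrite csum_bdiff; cfield; apply lam_neq_0.
  - intros k; cfield; apply dlam_neq_0.
Qed.

Section Coefficients.

Variable a : cseq.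

Definition bcoef : cseq := fun i => (a i / RtoC (dlam lam i))%C.
Definition ccoef : cseq := fun j => (Dbar bcoef j * RtoC (lam j))%C.

Lemma csum_mul (x : cseq) (n : nat) :
  csum (fun k => a k * x k)%C n =
  (csum (fun k => Dbar ccoef k * csum (Lam lam x) k) n
   + ccoef (S n) * csum (Lam lam x) n
   + bcoef (S n) * RtoC (lam n) * Lam lam x n)%C.
Proof.
  (* The second summation by parts is undone on the right first; the first one, with [a k * x k]
     written as [bcoef k] times a backward difference, then gives the left side. *)
  rewrite <- (csum_by_parts ccoef (csum (Lam lam x))).
  rewrite (sum_n_ext (fun k => ccoef k * bdiff (csum (Lam lam x)) k)%C
    (fun k => ccoef k * Lam lam x k)%C) by (intros k; now rewrite bdiff_csum).
  rewrite (sum_n_ext (fun k => a k * x k)%C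
    (fun k => bcoef k * bdiff (fun i => RtoC (lam i) * Lam lam x i) k)%C).
  - rewrite csum_by_parts.
    rewrite (sum_n_ext _ (fun k => ccoef k * Lam lam x k)%C)
      by (intros k; unfold ccoef; cring).
    cring.
  - intros k; rewrite bdiff_Lam; unfold bcoef; cfield; apply dlam_neq_0.
Qed.

(** Since [y n = s n - s (n-1)], the boundary terms of [csum_mul] touch only columns [n] and [n-1].
    For [n = 0] the last test never succeeds, in agreement with [bdiff s 0 = s 0]. *)
Definition dual_row (n k : nat) : C :=
  (Dbar ccoef k
   + (if (k =? n)%nat then ccoef (S n) + bcoef (S n) * RtoC (lam n) else RtoC 0)
   + (if (S k =? n)%nat then - (bcoef (S n) * RtoC (lam n)) else RtoC 0))%C.

Lemma csum_dual_row (s : cseq) (n : nat) :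
  csum (fun k => dual_row n k * s k)%C n =
  (csum (fun k => Dbar ccoef k * s k) n
   + ccoef (S n) * s n + bcoef (S n) * RtoC (lam n) * bdiff s n)%C.
Proof.
  rewrite (sum_n_ext _ (fun k =>
    Dbar ccoef k * s k
    + (if (k =? n)%nat
       then (ccoef (S n) + bcoef (S n) * RtoC (lam n)) * s k else RtoC 0)
    + (if (S k =? n)%nat
       then - (bcoef (S n) * RtoC (lam n)) * s k else RtoC 0))%C).
  - rewrite 2!csum_plus, csum_delta, Nat.leb_refl.
    destruct n as [|n].
    + rewrite (csum_0 (fun k => if (S k =? 0)%nat then _ else _)); simpl; cring.
    + simpl Nat.eqb.
      rewrite (csum_delta (fun k => - (bcoef (S (S n)) * RtoC (lam (S n))) * s k)%C).
      destruct (Nat.leb_spec n (S n)); [simpl; ring|lia].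
  - intros k; unfold dual_row; destruct (k =? n)%nat, (S k =? n)%nat; cring.
Qed.

Lemma m4_lamE : m4_lam lam a <->
  exists M : R, forall k, Cmod (bcoef k * RtoC (lam k))%C <= M.
Proof.
  assert (E : forall k, (RtoC (lam k) / RtoC (dlam lam k) * a k =
                         bcoef k * RtoC (lam k))%C).
  { intros k; unfold bcoef; cfield; apply dlam_neq_0. }
  unfold m4_lam.
  pose proof (Sup_seq_correct (fun k : nat =>
       Finite (Cmod (RtoC (lam k) / RtoC (dlam lam k) * a k)%C))) as H.
  destruct (Sup_seq _) as [l| |]; simpl in *.
  - split; [intros _|trivial].
    (* The supremum is characterised up to any positive margin; here the margin is 1. *)
    exists (l + 1); intros k; rewrite <- E.
    left; apply (H (mkposreal 1 Rlt_0_1)).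
  - split; [easy|intros [M HM]].
    destruct (H M) as [k Hk]; rewrite E in Hk.
    elim (Rlt_not_le _ _ Hk); apply HM.
  (* A supremum of minus infinity would force a modulus below 0. *)
  - specialize (H 0 0%nat); elim (Rlt_not_le _ _ H).
    apply Cmod_ge_0.
Qed.

Lemma m3_lamE : m3_lam lam a <->
  exists M : R, forall n, rsum (fun k => Cmod (Dbar ccoef k)) n <= M.
Proof.
  change (m3_lam lam a) with (ex_series (fun k => Cmod (Dbar ccoef k))).
  split.
  - intros H; destruct (filterlim_bounded _ H) as [M HM].
    exists M; intros n; apply Rle_trans with (2 := HM n), Rle_abs.
  - intros [M HM].
    destruct (ex_finite_lim_seq_incr (rsum (fun k => Cmod (Dbar ccoef k))) M)
      as [l Hl]; [|exact HM|now exists l].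
    intros n; rewrite rsum_S; pose proof (Cmod_ge_0 (Dbar ccoef (S n))); lra.
Qed.

Lemma cs0_dual_sub :
  gamma_dual (cs0_lam lam) a -> m3_lam lam a /\ m4_lam lam a.
Proof.
  intros H.
  destruct (rows_bounded dual_row) as [M HM].
  { intros s Hs.
    destruct (H (Lam_inv (bdiff s))) as [M HM].
    - apply filterlim_ext with s; [intros n|exact Hs].
      rewrite (sum_n_ext _ (bdiff s)) by apply Lam_Lam_inv.
      now rewrite csum_bdiff.
    - exists M; intros n; rewrite csum_dual_row.
      specialize (HM n); rewrite csum_mul, Lam_Lam_inv in HM.
      rewrite (sum_n_ext (Lam lam (Lam_inv (bdiff s))) (bdiff s)) in HM
        by apply Lam_Lam_inv.
      rewrite csum_bdiff in HM.
      rewrite (sum_n_ext _ (fun k => Dbar ccoef k * s k)%C) in HM; [exact HM|].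
      intros k; rewrite (sum_n_ext _ (bdiff s)) by apply Lam_Lam_inv.
      now rewrite csum_bdiff. }
  rewrite m3_lamE, m4_lamE; split; exists M; intros n.
  (* In row [n+2] the exceptional columns are [n+1] and [n+2], so columns up to [n] hold exactly
     [Dbar ccoef k]. *)
  - apply Rle_trans with (2 := HM (S (S n))).
    apply Rle_trans with (rsum (fun k => Cmod (dual_row (S (S n)) k)) n).
    + apply rsum_le; intros k Hk; unfold dual_row.
      destruct (Nat.eqb_spec k (S (S n))), (Nat.eqb_spec (S k) (S (S n))); try lia.
      right; f_equal; cring.
    + apply rsum_le_len; [intros; apply Cmod_ge_0|lia].
  - apply Rle_trans with (2 := HM n).
    (* On the diagonal [ccoef (n+1)] cancels, then so does [bcoef (n+1) * lam n]. *)
    replace (bcoef n * RtoC (lam n))%C with (dual_row n n).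
    + apply (rsum_term_le (fun k => Cmod (dual_row n k)));
        [intros; apply Cmod_ge_0|lia].
    + unfold dual_row; rewrite Nat.eqb_refl.
      destruct (Nat.eqb_spec (S n) n); [lia|].
      unfold Dbar, ccoef, Dbar; cring.
Qed.

Lemma sub_bs_dual :
  m3_lam lam a -> m4_lam lam a -> gamma_dual (bs_lam lam) a.
Proof.
  rewrite m3_lamE, m4_lamE; intros [A HA] [B HB] x [M HM].
  (* Monotonicity of [lam] transfers the bound from [bcoef (n+1) * lam (n+1)]. *)
  assert (HB' : forall n, Cmod (bcoef (S n) * RtoC (lam n))%C <= B).
  { intros n; apply Rle_trans with (2 := HB (S n)).
    rewrite !Cmod_mult, !Cmod_R, !Rabs_pos_eq by (left; apply lam_pos).
    apply Rmult_le_compat_l; [apply Cmod_ge_0|].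
    left; apply lam_incr; lia. }
  assert (Hc : forall n, Cmod (ccoef n) <= B + B).
  { intros n.
    replace (ccoef n) with (bcoef n * RtoC (lam n) + - (bcoef (S n) * RtoC (lam n)))%C
      by (unfold ccoef, Dbar; cring).
    apply Rle_trans with (1 := Cmod_triangle _ _); rewrite Cmod_opp.
    apply Rplus_le_compat; auto. }
  assert (Hy : forall n, Cmod (Lam lam x n) <= M + M).
  { intros n; rewrite <- bdiff_csum; destruct n as [|n]; simpl.
    - pose proof (HM 0%nat); pose proof (Cmod_ge_0 (csum (Lam lam x) 0)); lra.
    - unfold Cminus.
      apply Rle_trans with (1 := Cmod_triangle _ _); rewrite Cmod_opp.
      apply Rplus_le_compat; auto. }
  assert (M0 : 0 <= M) by apply Rle_trans with (2 := HM 0%nat), Cmod_ge_0.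
  (* One summand for each of the three terms of [csum_mul]. *)
  exists (A * M + (B + B) * M + B * (M + M)); intros n.
  rewrite csum_mul.
  apply Rle_trans with (1 := Cmod_triangle _ _); apply Rplus_le_compat.
  - apply Rle_trans with (1 := Cmod_triangle _ _); apply Rplus_le_compat.
    + apply Rle_trans with (1 := Cmod_csum_le _ _).
      apply Rle_trans with (rsum (fun k => Cmod (Dbar ccoef k)) n * M).
      * rewrite <- (sum_n_mult_r (K := R_Ring) M).
        apply rsum_le; intros k _; rewrite Cmod_mult.
        apply Rmult_le_compat_l; [apply Cmod_ge_0|apply HM].
      * apply Rmult_le_compat_r; auto.
    + rewrite Cmod_mult; apply Rmult_le_compat; auto using Cmod_ge_0.
  - rewrite Cmod_mult; apply Rmult_le_compat; auto using Cmod_ge_0.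
Qed.

End Coefficients.

End Lambda.

(** * Inclusions between the spaces and the conclusion *)

Lemma gamma_dual_anti (X Y : seq_space) (a : cseq) :
  (forall x, X x -> Y x) -> gamma_dual Y a -> gamma_dual X a.
Proof. intros XY H x Xx; apply H, XY, Xx. Qed.

Lemma cs0_sub_cs (x : cseq) : cs0 x -> cs x.
Proof. intros H; now exists (RtoC 0). Qed.

Lemma cs_sub_bs (x : cseq) : cs x -> bs x.
Proof. intros H; destruct (filterlim_bounded _ H) as [M HM]; now exists M. Qed.

Theorem theorem5p12 (lam : nat -> R)
  (lam_pos : forall k : nat, 0 < lam k)
  (lam_incr : forall m n : nat, (m < n)%nat -> lam m < lam n)
  (lam_infty : is_lim_seq lam p_infty) :
  (forall a : cseq,
     gamma_dual (cs_lam lam) a <-> m3_lam lam a /\ m4_lam lam a) /\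
  (forall a : cseq,
     gamma_dual (cs0_lam lam) a <-> m3_lam lam a /\ m4_lam lam a) /\
  (forall a : cseq,
     gamma_dual (bs_lam lam) a <-> m3_lam lam a /\ m4_lam lam a).
Proof.
  (* Duals reverse the inclusions of [cs0], [cs] and [bs], so necessity is needed only for the
     smallest space and sufficiency only for the largest. *)
  assert (bs_cs : forall a, gamma_dual (bs_lam lam) a -> gamma_dual (cs_lam lam) a).
  { intros a; apply gamma_dual_anti; intros x; apply cs_sub_bs. }
  assert (cs_cs0 : forall a,
    gamma_dual (cs_lam lam) a -> gamma_dual (cs0_lam lam) a).
  { intros a; apply gamma_dual_anti; intros x; apply cs0_sub_cs. }
  assert (nec := cs0_dual_sub lam lam_pos lam_incr).
  assert (suf : forall a,
    m3_lam lam a /\ m4_lam lam a -> gamma_dual (bs_lam lam) a).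
  { intros a [H3 H4]; now apply sub_bs_dual. }
  repeat split; auto; now apply nec; auto.
Qed.
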